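(* Let $X$ be a locally compact Polish space and let $\sigma$ be a non-atomic Radon measure on $X$ with $\sigma(X)=\infty$. Let $\nu$ be a measure on $\mathbb R^*=\mathbb R\setminus\{0\}$ such that $\nu(\{s\in\mathbb R^*:|s|>R\})=0$ for some $R>0$. Let $\Lambda^{(n)}\in\mathscr B_0(X)$ with $\Lambda^{(1)}\subset\Lambda^{(2)}\subset\cdots$, $\bigcup_n\Lambda^{(n)}=X$, let $\Delta^{(n)}\in\mathscr B_0(\mathbb R^* )$ with $\Delta^{(1)}\subset\Delta^{(2)}\subset\cdots$, $\bigcup_n\Delta^{(n)}=\mathbb R^*$, let $V^{(n)}:=\sigma(\Lambda^{(n)})\nu(\Delta^{(n)})>0$, and let $N^{(n)}\in\mathbb N$ be (deterministic) numbers with $\lim_{n\to\infty}N^{(n)}/V^{(n)}=1$. For each $n$, let $A(\Lambda^{(n)}\times\Delta^{(n)},N^{(n)};f)$, $f\in B_0(X)$, and $\tau_{\Lambda^{(n)}\times\Delta^{(n)},N^{(n)}}$ be the operators and the trace describing the sum of $N^{(n)}$ freely independent random measures $s_i\delta_{x_i}$, where each $(x_i,s_i)$ has distribution $\frac1{V^{(n)}}\sigma\otimes\nu$ on $\Lambda^{(n)}\times\Delta^{(n)}$. (a) Assume that $\int_{\mathbb R^*}|s|\,d\nu(s)<\infty$. Let $A(f)$, $f\in B_0(X)$, and $\tau$ be the operators and the vacuum trace of the free Lévy white noise with Lévy measure $\nu$. Then, for any $k\in\mathbb N$ and $f_1,\dots,f_k\in B_0(X)$, $$\lim_{n\to\infty}\tau_{\Lambda^{(n)}\times\Delta^{(n)},N^{(n)}}\big(A(\Lambda^{(n)}\times\Delta^{(n)},N^{(n)};f_1)\cdots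 A(\Lambda^{(n)}\times\Delta^{(n)},N^{(n)};f_k)\big)=\tau\big(A(f_1)\cdots A(f_k)\big).$$ (b) Assume, instead of $\int_{\mathbb R^*}|s|\,d\nu(s)<\infty$, only that $\int_{\mathbb R^*}s^2\,d\nu(s)<\infty$. Let $\tilde A(f)$, $f\in B_0(X)$, be the operators of the centered free Lévy white noise with Lévy measure $\nu$, and let $$\tilde A(\Lambda\times\Delta,N;f):=A(\Lambda\times\Delta,N;f)-\tau_{\Lambda\times\Delta,N}\big(A(\Lambda\times\Delta,N;f)\big).$$ Then, for any $k\in\mathbb N$ and $f_1,\dots,f_k\in B_0(X)$, $$\lim_{n\to\infty}\tau_{\Lambda^{(n)}\times\Delta^{(n)},N^{(n)}}\big(\tilde A(\Lambda^{(n)}\times\Delta^{(n)},N^{(n)};f_1)\cdots\tilde A(\Lambda^{(n)}\times\Delta^{(n)},N^{(n)};f_k)\big)=\tau\big(\tilde A(f_1)\cdots\tilde A(f_k)\big).$$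
   Context: For a topological space $Y$, $\mathscr B_0(Y)$ is the collection of Borel subsets of $Y$ with compact closure; $\mathbb R^*$ carries its usual topology as a subset of $\mathbb R$, so a set in $\mathscr B_0(\mathbb R^* )$ is bounded and at positive distance from $0$. A measure on the Borel $\sigma$-algebra of $X$ is Radon if it is finite on every set of $\mathscr B_0(X)$. $B_0(X)$ is the set of all bounded measurable functions $f:X\to\mathbb R$ with compact support. For $f\in B_0(X)$, $f\otimes\mathrm{id}:X\times\mathbb R^*\to\mathbb R$ is $(f\otimes\mathrm{id})(x,s)=f(x)s$. All Hilbert spaces are real. **Free Lévy white noise.** For a real separable Hilbert space $H$, the full Fock space is $\mathscr F(H)=\bigoplus_{n=0}^\infty H^{\otimes n}$, $H^{\otimes 0}=\mathbb R$, with vacuum $\Omega=(1,0,0,\dots)$. For $h\in H$, $a^+(h)$ is the bounded operator with $a^+(h)f^{(n)}=h\otimes f^{(n)}$ for $f^{(n)}\in H^{\otimes n}$, and $a^-(h)$ is its adjoint, so that $a^-(h)\Omega=0$ and $a^-(h)f_1\otimes\dots\otimes f_n=(h,f_1)_H f_2\otimes\dots\otimes f_n$. For a bounded operator $L$ in $H$, $a^0(L)\Omega=0$ and $a^0(L)f_1\otimes\dots\otimes f_n=(Lf_1)\otimes f_2\otimes\dots\otimes f_n$. In $\mathscr F(L^2(X\times\mathbb R^*,\sigma\otimes\nu))$ define the bounded selfadjoint operators $$\tilde A(f)=a^+(f\otimes\mathrm{id})+a^0(f\otimes\mathrm{id})+a^-(f\otimes\mathrm{id}),\qquad A(f)=\tilde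 A(f)+\int_X f\,d\sigma\int_{\mathbb R^*}s\,d\nu(s)$$ (the latter when $\int|s|\,d\nu<\infty$), where in $a^0$ a function is identified with the operator of multiplication by it. $(A(f))_{f\in B_0(X)}$ is the free Lévy white noise with Lévy measure $\nu$, and $(\tilde A(f))_{f\in B_0(X)}$ the centered free Lévy white noise with Lévy measure $\nu$. The trace is $\tau(a)=(a\Omega,\Omega)$ on the algebra generated by the respective operators. **$N$ freely independent weighted atoms.** Let $\Lambda\in\mathscr B_0(X)$, $\Delta\in\mathscr B_0(\mathbb R^* )$, let $P$ be a probability measure on $E:=\Lambda\times\Delta$, and $N\in\mathbb N$. For $g\in L^2(E,P)$ put $\langle g\rangle=\int_E g\,dP$; let $H=\{g\in L^2(E,P):\langle g\rangle=0\}$ and let $H_1,\dots,H_N$ be $N$ copies of $H$. Define $$\mathscr H(E,N)=\mathbb R\oplus\bigoplus_{\substack{k\in\mathbb N,\ l_1,\dots,l_k\in\{1,\dots,N\}\\ l_j\ne l_{j+1}}}H_{l_1}\otimes\dots\otimes H_{l_k},\qquad\Psi_N=(1,0,0,\dots).$$ Let $[g]_i:=g-\langle g\rangle\in H_i$. For $f\in B_0(X)$ let $u:=(f\otimes\mathrm{id})|_E$, a bounded function. For $i\in\{1,\dots,N\}$, $M_i(E;f)$ is the bounded linear operator in $\mathscr H(E,N)$ given by $M_i(E;f)\Psi_N=\langle u\rangle\Psi_N+[u]_i$ and, for $g_j\in H_{l_j}$ with $l_j\ne l_{j+1}$: if $i\ne l_1$, $M_i(E;f)g_1\otimes\dots\otimes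 g_k=\langle u\rangle g_1\otimes\dots\otimes g_k+[u]_i\otimes g_1\otimes\dots\otimes g_k$; if $i=l_1$, $M_i(E;f)g_1\otimes\dots\otimes g_k=\langle ug_1\rangle g_2\otimes\dots\otimes g_k+[ug_1]_i\otimes g_2\otimes\dots\otimes g_k$ (for $k=1$, $g_2\otimes\dots\otimes g_k$ means $\Psi_N$ in the first term and is absent in the second). Then $$A(\Lambda\times\Delta,N;f)=\sum_{i=1}^N M_i(E;f),\qquad\tau_{\Lambda\times\Delta,N}(a)=(a\Psi_N,\Psi_N)_{\mathscr H(E,N)} .$$ In the claim this is used with $\Lambda=\Lambda^{(n)}$, $\Delta=\Delta^{(n)}$, $N=N^{(n)}$, $P=\frac1{V^{(n)}}\sigma\otimes\nu$. *)

(* Defs.v *)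
From HB Require Import structures.
From mathcomp Require Import all_boot all_order all_algebra.
From mathcomp Require Import all_classical all_reals all_analysis.
Import Order.TTheory GRing.Theory Num.Theory.
Import numFieldNormedType.Exports.

Set Implicit Arguments.
Unset Strict Implicit.
Unset Printing Implicit Defensive.

Local Open Scope classical_set_scope.
Local Open Scope ring_scope.

Definition borel (Y : ptopologicalType) := g_sigma_algebraType (@open Y).
HB.instance Definition _ (Y : ptopologicalType) := Measurable.on (borel Y).

(* The topology is the subspace topology, so that a compact subset of [Rstar R]
   is bounded and at positive distance from 0. *)
Definition Rstar (R : realType) : Type := set_type [set~ (0 : R)].
HB.instance Definition _ (R : realType) :=
  Topological.copy (Rstar R) (set_type [set~ (0 : R)]).

Definition rval (R : realType) (s : Rstar R) : R := val s.

Lemma one_in_Rstar (R : realType) : (1 : R) \in [set~ (0 : R)].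
Proof. by rewrite inE /=; apply/eqP; rewrite oner_eq0. Qed.

HB.instance Definition _ (R : realType) :=
  isPointed.Build (Rstar R) (exist _ 1 (one_in_Rstar R)).

Definition polish (R : realType) (Y : topologicalType) : Prop :=
  (exists2 D : set Y, countable D & dense D) /\
  exists dist : Y -> Y -> R,
    [/\ (forall x y, 0 <= dist x y) /\ (forall x y, dist x y = 0 <-> x = y),
        (forall x y, dist x y = dist y x) /\
          (forall x y z, dist x z <= dist x y + dist y z),
        forall (x : Y) (U : set Y),
          nbhs x U <-> exists2 e : R, 0 < e & [set y | dist x y < e] `<=` U &
        forall u : nat -> Y,
          (forall e : R, 0 < e -> exists m, forall i j,
             (m <= i)%N -> (m <= j)%N -> dist (u i) (u j) < e) ->
          exists l : Y, u @ \oo --> l].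

Definition borel_relcompact (Y : ptopologicalType) (A : set Y) : Prop :=
  measurable (A : set (borel Y)) /\ compact (closure A).

Definition radon (R : realType) (Y : ptopologicalType)
    (mu : {measure set (borel Y) -> \bar R}) : Prop :=
  forall A : set Y, borel_relcompact A -> (mu A < +oo)%E.

Definition non_atomic d (T : measurableType d) (R : realType)
    (mu : {measure set T -> \bar R}) : Prop :=
  forall A : set T, measurable A -> (0 < mu A)%E ->
  exists B : set T, [/\ measurable B, B `<=` A, (0 < mu B)%E & (mu B < mu A)%E].

Definition bounded_compact_support (R : realType) (Y : ptopologicalType)
    (f : Y -> R) : Prop :=
  [/\ measurable_fun setT (f : borel Y -> R),
      exists C : R, forall x, `|f x| <= C &
      compact (closure [set x | f x != 0])].

Definition otimes_id (R : realType) (Y : ptopologicalType) (f : Y -> R)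
  (z : borel Y * borel (Rstar R)) : R := f z.1 * rval z.2.

Lemma inv_mass_ge0 d (T : measurableType d) (R : realType)
  (mu : {measure set T -> \bar R}) (E : set T) : 0 <= (fine (mu E))^-1.
Proof. by rewrite invr_ge0 fine_ge0. Qed.

(* [mu] restricted to [E] and divided by [mu E]; a probability measure
   when [0 < mu E < +oo]. *)
Definition normalized_restriction d (T : measurableType d) (R : realType)
    (mu : {measure set T -> \bar R}) (E : set T) (mE : measurable E) :
    {measure set T -> \bar R} :=
  mscale (NngNum (inv_mass_ge0 mu E)) (mrestr mu mE).

Lemma borel_relcompact_setX (R : realType) (Y : ptopologicalType)
    (A : set Y) (B : set (Rstar R)) :
  borel_relcompact A -> borel_relcompact B ->
  measurable (A `*` B : set (borel Y * borel (Rstar R))).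
Proof. by move=> [mA _] [mB _]; exact: measurableX. Qed.

HB.mixin Record CompleteNormedModule_isHilbert (R : realType) V
    & CompleteNormedModule R V := {
  hdot : V -> V -> R ;
  hdotC : forall u v, hdot u v = hdot v u ;
  hdot_linearl : forall (a : R) u v w,
    hdot (a *: u + v) w = a * hdot u w + hdot v w ;
  hdotxx : forall u, hdot u u = `|u| ^+ 2
}.

#[short(type="hilbertType")]
HB.structure Definition Hilbert (R : realType) :=
  {V of CompleteNormedModule_isHilbert R V & CompleteNormedModule R V}.

Definition bounded_operator (R : realType) (V : hilbertType R)
    (T : V -> V) : Prop :=
  linear T /\ exists C : R, forall v, `|T v| <= C * `|v|.

Definition adjoint_of (R : realType) (V : hilbertType R)
    (T S : V -> V) : Prop :=
  bounded_operator S /\ forall u v, hdot (S u) v = hdot u (T v).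

Definition vector_state (R : realType) (V : hilbertType R) (Omega : V)
  (T : V -> V) : R := hdot (T Omega) Omega.

Definition linear_span (R : realType) (V : lmodType R) (S : set V) : set V :=
  [set v | exists (m : nat) (c : 'I_m -> R) (w : 'I_m -> V),
     (forall i, S (w i)) /\ v = \sum_(i < m) c i *: w i].

Definition L2dot d (T : measurableType d) (R : realType)
    (mu : {measure set T -> \bar R}) (g h : T -> R) : R :=
  \int[mu]_x (g x * h x).

(* Realizations of the Hilbert direct sum of the tensor powers of L^2(mu):
   [fock_tensor [:: g_1; ...; g_n]] is g_1 (x) ... (x) g_n, and
   [fock_tensor [::]] is the vacuum.  The two conditions determine the space
   together with its simple tensors up to a unique unitary, and they make
   [fock_tensor] multilinear and compatible with a.e. equality.  The value of
   [fock_tensor] on a word with a letter outside L^2(mu) is irrelevant. *)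
Record full_fock_space d (T : measurableType d) (R : realType)
    (mu : {measure set T -> \bar R}) := FullFockSpace {
  fock_sort :> hilbertType R ;
  fock_tensor : seq (T -> R) -> fock_sort ;
  fock_tensor_dot : forall v w : seq (T -> R),
    {subset v <= Lfun mu 2%:E} -> {subset w <= Lfun mu 2%:E} ->
    hdot (fock_tensor v) (fock_tensor w) =
      if size v == size w
      then \prod_(p <- zip v w) L2dot mu p.1 p.2 else 0 ;
  fock_tensor_total :
    dense (linear_span
      (fock_tensor @` [set w | {subset w <= Lfun mu 2%:E}]))
}.

Section fock_operators.
Context d (T : measurableType d) (R : realType).
Context (mu : {measure set T -> \bar R}) (F : full_fock_space mu).

Definition vacuum : F := fock_tensor F [::].

Definition creation_operator (h : T -> R) (A : F -> F) : Prop :=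
  bounded_operator A /\
  forall w, {subset w <= Lfun mu 2%:E} ->
    A (fock_tensor F w) = fock_tensor F (h :: w).

(* [L] acts on representatives of the classes in L^2(mu). *)
Definition neutral_operator (L : (T -> R) -> (T -> R)) (A : F -> F) : Prop :=
  [/\ bounded_operator A, A vacuum = 0 &
      forall g w, g \in Lfun mu 2%:E -> {subset w <= Lfun mu 2%:E} ->
        A (fock_tensor F (g :: w)) = fock_tensor F (L g :: w)].

Definition multiplication (h g : T -> R) : T -> R := h \* g.

End fock_operators.

(* [ap h], [a0 h], [am h] stand for a^+(h), a^0(h), a^-(h). *)
Definition centered_free_levy_noise (R : realType) (X : ptopologicalType)
    (V : lmodType R) (ap a0 am : (borel X * borel (Rstar R) -> R) -> V -> V)
    (f : X -> R) : V -> V :=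
  fun v => ap (otimes_id f) v + a0 (otimes_id f) v + am (otimes_id f) v.

Definition free_levy_noise (R : realType) (X : ptopologicalType)
    (sigma : {measure set (borel X) -> \bar R})
    (nu : {measure set (borel (Rstar R)) -> \bar R})
    (V : lmodType R) (ap a0 am : (borel X * borel (Rstar R) -> R) -> V -> V)
    (f : X -> R) : V -> V :=
  fun v => centered_free_levy_noise ap a0 am f v +
    ((\int[sigma]_x f x) * (\int[nu]_s rval s)) *: v.

Section free_product.
Context d (T : measurableType d) (R : realType).
Context (P : {measure set T -> \bar R}) (N : nat).

Definition L2_centered : set (T -> R) :=
  [set g | g \in Lfun P 2%:E /\ \int[P]_x g x = 0].

(* The letter (i, g) is the element g of the i-th copy of [L2_centered].  When
   [P] is concentrated on a set E, functions on [T] represent the elements of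
   L^2(E, P), so that no restriction to E is needed. *)
Definition alternating_word (w : seq ('I_N * (T -> R))) : Prop :=
  sorted (fun p q => p.1 != q.1) w /\
  forall p, p \in w -> L2_centered p.2.

(* Realizations of R (+) (+)_(l_1 <> l_2 <> ...) H_(l_1) (x) ... (x) H_(l_k), in
   the same sense as for [full_fock_space]. *)
Record free_product_space := FreeProductSpace {
  free_sort :> hilbertType R ;
  free_tensor : seq ('I_N * (T -> R)) -> free_sort ;
  free_tensor_dot : forall v w,
    alternating_word v -> alternating_word w ->
    hdot (free_tensor v) (free_tensor w) =
      if unzip1 v == unzip1 w
      then \prod_(p <- zip (unzip2 v) (unzip2 w)) L2dot P p.1 p.2 else 0 ;
  free_tensor_total :
    dense (linear_span (free_tensor @` [set w | alternating_word w]))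
}.

Definition free_vacuum (K : free_product_space) : K := free_tensor K [::].

Definition center (g : T -> R) : T -> R := fun x => g x - \int[P]_y g y.

(* The free representation of multiplication by [u] in the i-th copy. *)
Definition free_multiplication (K : free_product_space) (u : T -> R) (i : 'I_N)
    (M : K -> K) : Prop :=
  [/\ bounded_operator M,
      M (free_vacuum K) = (\int[P]_x u x) *: free_vacuum K +
        free_tensor K [:: (i, center u)],
      forall l g w, alternating_word ((l, g) :: w) -> i != l ->
        M (free_tensor K ((l, g) :: w)) =
          (\int[P]_x u x) *: free_tensor K ((l, g) :: w) +
          free_tensor K ((i, center u) :: (l, g) :: w) &
      forall g w, alternating_word ((i, g) :: w) ->
        M (free_tensor K ((i, g) :: w)) =
          (\int[P]_x (u x * g x)) *: free_tensor K w +
          free_tensor K ((i, center (u \* g)) :: w)].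

Definition free_sum (V : lmodType R) (M : 'I_N -> V -> V) : V -> V :=
  fun v => \sum_(i < N) M i v.

End free_product.

Definition op_prod (V : Type) (k : nat) (A : 'I_k -> V -> V) : V -> V :=
  \big[(fun S T : V -> V => S \o T)/idfun]_(i < k) A i.

Definition center_op (R : realType) (V : hilbertType R) (Omega : V)
    (A : V -> V) : V -> V :=
  fun v => A v - vector_state Omega A *: v.

(* Main.v *)
From HB Require Import structures.
Require Import Defs.
From mathcomp Require Import all_boot all_order all_algebra.
From mathcomp Require Import all_classical all_reals all_analysis.
From mathcomp Require Import measurable_realfun lra.
Import Order.TTheory GRing.Theory Num.Theory.
Import numFieldNormedType.Exports.
Local Open Scope classical_set_scope.
Local Open Scope ring_scope.

(** Both sides are moments of the same kind of dynamics on words of functions, and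
    the convergence of the moments reduces to that of the weights of this dynamics.

    Write [u] for [otimes_id f] and [mu] for [sigma \x nu].  In the full Fock space,
    the noise sends the word [g_1 (x) ... (x) g_m] to the sum of
    [u (x) g_1 (x) ... (x) g_m], of [(u g_1) (x) g_2 (x) ... (x) g_m] and of
    [(u, g_1) g_2 (x) ... (x) g_m], plus a multiple of the word itself in the
    non-centered case ([fock_acts_on_words]).

    In the free product let [<g>] be the mean of [g] under the normalized restriction
    of [mu], and let [W(g_1 ... g_m)] be the sum over all indices
    [i_1 <> i_2 <> ... <> i_m] of the simple tensors of the centered [g_j] in the
    copies [i_j].  Summing the [N] free copies of the multiplication by [u] preserves
    the span of these vectors ([free_sum_acts_on_words]):
    [W(g_1 ... g_m)] is sent to
    [(N - 1) <u> W(g_1 ... g_m) + W(u g_1 ... g_m) + W((u g_1) g_2 ... g_m)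
     - <g_1> W(u g_2 ... g_m) + N' (<u g_1> - <u> <g_1>) W(g_2 ... g_m)],
    where the juxtaposed letters form a word, the parenthesised ones are multiplied,
    and [N'] is [N] if [m = 1] and [N - 1] otherwise.  In both spaces the state reads
    off the coefficient of the empty word, so that both traces are given by one
    recursion [moment], polynomial in the weights ([vector_state_op_prod],
    [cvg_moment]).

    It remains to compare the weights.  As [N / V] tends to 1, [N <g>] tends to the
    integral of [g] against [mu] whenever [g] is integrable ([cvg_N_mean]): this holds
    for all products of two letters, and for single letters if [s] is [nu]-integrable.
    Moreover [<g>] tends to 0 ([cvg_mean]).  The delicate weight is [N <u> <g>], since
    under a second moment condition single letters need not be integrable.  The
    Cauchy-Schwarz inequality on the support of [f] times [Delta] bounds the integral
    of a letter by a multiple of the square root of [nu Delta]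
    ([levy_letter_bound]), so that [N <u> <g>] is at most of order
    [nu Delta / V = 1 / sigma Lambda] ([cvg_V_mean_mean]), and this vanishes since
    [sigma] is infinite.  Centering subtracts [N <u>], and so turns the loop weights
    into 0 and [- <u>], which both tend to 0. *)

Set Implicit Arguments.
Unset Strict Implicit.
Unset Printing Implicit Defensive.

(** * Real Hilbert spaces and linear operators *)

Section hilbert.
Context (R : realType) (V : hilbertType R).
Implicit Types u v w : V.

Lemma hdotDl u v w : hdot (u + v) w = hdot u w + hdot v w.
Proof. by rewrite -[u]scale1r hdot_linearl scale1r mul1r. Qed.

Lemma hdot0l w : hdot 0 w = 0.
Proof. by apply: (addrI (hdot 0 w)); rewrite -hdotDl !addr0. Qed.

Lemma hdotZl (a : R) v w : hdot (a *: v) w = a * hdot v w.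
Proof. by rewrite -[a *: v]addr0 hdot_linearl hdot0l addr0. Qed.

Lemma hdotBl u v w : hdot (u - v) w = hdot u w - hdot v w.
Proof. by rewrite -scaleN1r hdotDl hdotZl mulN1r. Qed.

Lemma hdotBr u v w : hdot w (u - v) = hdot w u - hdot w v.
Proof. by rewrite hdotC hdotBl !(hdotC w). Qed.

Lemma hdotDr u v w : hdot w (u + v) = hdot w u + hdot w v.
Proof. by rewrite hdotC hdotDl !(hdotC w). Qed.

Lemma hdotZr (a : R) v w : hdot w (a *: v) = a * hdot w v.
Proof. by rewrite hdotC hdotZl (hdotC w). Qed.

Lemma hdot_sumr (I : Type) (r : seq I) (P : pred I) (F : I -> V) w :
  hdot w (\sum_(i <- r | P i) F i) = \sum_(i <- r | P i) hdot w (F i).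
Proof.
apply: (big_morph (hdot w)) => [u v|]; first exact: hdotDr.
by rewrite hdotC hdot0l.
Qed.

Lemma hdot_eq0 v : hdot v v = 0 -> v = 0.
Proof. by rewrite hdotxx => /eqP; rewrite sqrf_eq0 normr_eq0 => /eqP. Qed.

Lemma hdot_subo v w : hdot v w = 0 ->
  hdot (v - w) (v - w) = hdot v v + hdot w w.
Proof.
by move=> vw; rewrite hdotBl !hdotBr (hdotC w v) vw subr0 sub0r opprK.
Qed.

(** If [u - v] is orthogonal to the span of [D], any [w] in that span is, by
    Pythagoras, at distance at least [`|u - v|] from [u - v]; density then
    forces this distance to be 0. *)
Lemma dense_orthogonal_eq (D : set V) u v : dense (linear_span D) ->
  (forall w, D w -> hdot u w = hdot v w) -> u = v.
Proof.
move=> dD uvD; apply/eqP; rewrite -subr_eq0 -normr_le0.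
apply/ler_addgt0Pl => e e0; rewrite addr0.
have [|w [uvw [m [c [x [xD wE]]]]]] := dD (ball (u - v) e) _ (ball_open _ _).
  by by exists (u - v); exact: ballxx.
have d0 : hdot (u - v) w = 0.
  rewrite wE hdot_sumr big1// => i _.
  by rewrite hdotZr hdotBl (uvD _ (xD i)) subrr mulr0.
move: uvw; rewrite -ball_normE /= => uvw; apply: le_trans (ltW uvw).
rewrite -(@ler_pXn2r _ 2)// ?nnegrE// -!hdotxx.
by rewrite (hdot_subo d0) lerDl hdotxx sqr_ge0.
Qed.

End hilbert.

Section operators.
Context (R : realType) (V : lmodType R) (A : V -> V).
Hypothesis lA : linear A.

Lemma linear_fun0 : A 0 = 0.
Proof. by have := lA (-1) 0 0; rewrite scaler0 addr0 scaleN1r addNr. Qed.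

Lemma linear_funD u v : A (u + v) = A u + A v.
Proof. by have := lA 1 u v; rewrite !scale1r. Qed.

Lemma linear_funZ a v : A (a *: v) = a *: A v.
Proof. by rewrite -[a *: v]addr0 lA linear_fun0 addr0. Qed.

End operators.

(** * Dynamics on words and their moments *)

Section word_moments.
Context (R : realType) (T : Type).
Implicit Types (u g : T -> R) (us w : seq (T -> R)) (good : set (T -> R)).

(** Weights of the elementary moves made by a word [g :: w] under an operator
    with symbol [u]: [loop] keeps the word, [swap] replaces [g] by [u] (with a
    minus sign), [contract] erases [g].  The two moves that create [u] or
    multiply [g] by [u] have weight 1.  The empty word has its own loop weight
    [loop0], and the boolean argument of [contract] tells whether [w] is empty:
    in the free product with N factors, an index may be added in front of the
    empty word in N ways and in front of any other word in only N - 1 ways. *)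
Record step_weights := StepWeights {
  loop0 : (T -> R) -> R ;
  loop : (T -> R) -> R ;
  swap : (T -> R) -> R ;
  contract : bool -> (T -> R) -> (T -> R) -> R
}.

(** Total weight of the paths from [w] to the empty word, the operator with
    symbol [head us] acting first. *)
Fixpoint moment (c : step_weights) us w : R :=
  if us is u :: us' then
    if w is g :: w' then
      loop c u * moment c us' w + moment c us' (u :: w) +
      moment c us' (u \* g :: w') - swap c g * moment c us' (u :: w') +
      contract c (nilp w') u g * moment c us' w'
    else loop0 c u * moment c us' [::] + moment c us' [:: u]
  else (nilp w)%:R.

Definition good_word good w := forall g, g \in w -> good g.

Lemma good_word_cons good g w :
  good_word good (g :: w) <-> good g /\ good_word good w.
Proof.
split=> [gw|[gg gw] h]; last by rewrite inE => /predU1P[->//|/gw].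
by split=> [|h hw]; apply: gw; rewrite inE ?eqxx// hw orbT.
Qed.

Definition acts_on_words (V : lmodType R) (W : seq (T -> R) -> V)
    (c : step_weights) good u (B : V -> V) : Prop :=
  B (W [::]) = loop0 c u *: W [::] + W [:: u] /\
  forall g w, good_word good (g :: w) ->
    B (W (g :: w)) = loop c u *: W (g :: w) + W (u :: g :: w) +
      W (u \* g :: w) - swap c g *: W (u :: w) +
      contract c (nilp w) u g *: W w.

(** [op_prod] composes with the last operator innermost, so it is this operator
    that has to be split off in order to follow the word it acts on. *)
Lemma big_comp_rcons (V I : Type) (A : I -> V -> V) s i v :
  (\big[(fun S T : V -> V => S \o T)/idfun]_(j <- rcons s i) A j) v =
  (\big[(fun S T : V -> V => S \o T)/idfun]_(j <- s) A j) (A i v).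
Proof. by elim: s => [|j s ih]; rewrite /= !big_cons ?big_nil//= ih. Qed.

Lemma linear_big_comp (V : lmodType R) (I : Type) (A : I -> V -> V) s :
  (forall i, linear (A i)) ->
  linear (\big[(fun S T : V -> V => S \o T)/idfun]_(j <- s) A j).
Proof.
move=> lA; elim: s => [|j s ih] a x y; first by rewrite big_nil.
by rewrite big_cons /= ih lA.
Qed.

(** Two spaces in which operators act on families of word vectors with the same
    weights have the same moments: each step expands [B (W w)] over word vectors, and
    in the end only the components along [W [::]] are read off. *)
Lemma vector_state_op_prod (V : hilbertType R) (W : seq (T -> R) -> V)
    c good (k : nat) (u : 'I_k -> T -> R) (B : 'I_k -> V -> V) :
  (forall v g, good v -> good g -> good (v \* g)) ->
  (forall w, good_word good w -> hdot (W w) (W [::]) = (nilp w)%:R) ->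
  (forall j, good (u j)) -> (forall j, linear (B j)) ->
  (forall j, acts_on_words W c good (u j) (B j)) ->
  vector_state (W [::]) (op_prod B) =
    moment c (rev [seq u j | j <- index_enum 'I_k]) [::].
Proof.
move=> goodM dotW gu lB actB; rewrite /vector_state /op_prod.
suff main s w : good_word good w ->
    hdot ((\big[(fun S T : V -> V => S \o T)/idfun]_(j <- s) B j) (W w))
      (W [::]) = moment c (rev [seq u j | j <- s]) w by exact: main.
elim/last_ind: s w => [|s j ih] w gw; first by rewrite big_nil dotW.
rewrite big_comp_rcons map_rcons rev_rcons /=.
have lC := linear_big_comp s lB.
case: w gw => [_|g w /[dup] ggw /good_word_cons[gg gw]].
  rewrite (actB j).1 (linear_funD lC) (linear_funZ lC) hdotDl hdotZl !ih//.
  exact/good_word_cons.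
rewrite (actB j).2// !(linear_funD lC) -scaleNr !(linear_funZ lC).
rewrite !hdotDl !hdotZl mulNr !ih//; do ?[exact/good_word_cons].
by apply/good_word_cons; split => //; exact: goodM.
Qed.

(** A moment is a polynomial in the weights. *)
Lemma cvg_moment good (c_ : nat -> step_weights) (c : step_weights) us :
  (forall v g, good v -> good g -> good (v \* g)) ->
  (forall u, good u -> loop0 (c_ n) u @[n --> \oo] --> loop0 c u) ->
  (forall u, good u -> loop (c_ n) u @[n --> \oo] --> loop c u) ->
  (forall u, good u -> swap (c_ n) u @[n --> \oo] --> swap c u) ->
  (forall b u g, good u -> good g ->
    contract (c_ n) b u g @[n --> \oo] --> contract c b u g) ->
  good_word good us ->
  moment (c_ n) us [::] @[n --> \oo] --> moment c us [::].
Proof.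
move=> goodM cl0 cl cs cc.
have : good_word good [::] by [].
elim: us [::] => [|u us ih] w gw; first by move=> _; exact: cvg_cst.
move=> /good_word_cons[gu gus] /=.
case: w gw => [_|g w /[dup] ggw /good_word_cons[gg gw]].
  apply: cvgD; last by apply: ih => //; exact/good_word_cons.
  by apply: cvgM; [exact: cl0|exact: ih].
have gugw : good_word good (u \* g :: w).
  by apply/good_word_cons; split => //; exact: goodM.
apply: cvgD; last by apply: cvgM; [exact: cc|exact: ih].
apply: cvgB; last first.
  by apply: cvgM; [exact: cs|apply: ih => //; exact/good_word_cons].
apply: cvgD; last exact: ih.
apply: cvgD; last by apply: ih => //; exact/good_word_cons.
by apply: cvgM; [exact: cl|exact: ih].
Qed.

End word_moments.

(** * Square-integrable functions *)

Section square_integrable.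
Context d (T : measurableType d) (R : realType).
Context (mu : {measure set T -> \bar R}).
Implicit Types f g h : T -> R.

Lemma Lfun2P f : measurable_fun setT f ->
  (\int[mu]_x (f x ^+ 2)%:E < +oo)%E -> f \in Lfun mu 2%:E.
Proof.
move=> mf foo; apply/andP; split; rewrite inE//=.
rewrite /finite_norm unlock poweR_lty//.
by under eq_integral do rewrite /= powR_mulrn// real_normK ?num_real//.
Qed.

Lemma Lfun2_subZ f g r : f \in Lfun mu 2%:E -> g \in Lfun mu 2%:E ->
  (fun x => f x - r * g x) \in Lfun mu 2%:E.
Proof.
move=> f2 g2; have le12 : (1 <= 2%:E :> \bar R)%E by rewrite lee_fin ler1n.
have [_ Lc] := Lfun_submod_closed mu le12.
rewrite (_ : (fun x => _) = - r *: g + f); first exact: Lc.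
by apply/funext => x; rewrite addrC -mulNr.
Qed.

Lemma Rintegral_subZ f g r : mu.-integrable setT (EFin \o f) ->
  mu.-integrable setT (EFin \o g) ->
  \int[mu]_x (f x - r * g x) = \int[mu]_x f x - r * \int[mu]_x g x.
Proof.
move=> fi gi; rewrite RintegralB ?RintegralZl//.
exact: (integrableZl measurableT r gi).
Qed.

Lemma L2dot_subl f g h r : f \in Lfun mu 2%:E -> g \in Lfun mu 2%:E ->
  h \in Lfun mu 2%:E ->
  L2dot mu (fun x => f x - r * g x) h = L2dot mu f h - r * L2dot mu g h.
Proof.
move=> f2 g2 h2; rewrite /L2dot.
under eq_Rintegral do rewrite mulrBl -mulrA.
by rewrite Rintegral_subZ//; apply/Lfun1_integrable; exact: Lfun2_mul_Lfun1.
Qed.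

End square_integrable.

(** * Sums over alternating index sequences *)

Section alternating_sums.
Context (N : nat) (L : eqType).
Implicit Types (w : seq L) (t : seq ('I_N * L)).

Definition may_precede (i : 'I_N) t := if t is p :: _ then i != p.1 else true.

(** Sum of [k t] over the [t] with letters [w] whose consecutive indices differ.
    The word is decorated from its tail, so that adding a letter in front only
    changes the summand [k]. *)
Fixpoint alt_sum (V : nmodType) w (k : seq ('I_N * L) -> V) : V :=
  if w is g :: w' then
    alt_sum w' (fun t => \sum_(i < N | may_precede i t) k ((i, g) :: t))
  else k [::].

Lemma eq_alt_sum (V : nmodType) w (k k' : seq ('I_N * L) -> V) :
  (forall t, unzip2 t = w -> sorted (fun p q => p.1 != q.1) t -> k t = k' t) ->
  alt_sum w k = alt_sum w k'.
Proof.
elim: w k k' => [|g w ih] k k' kk' /=; first exact: kk'.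
apply: ih => t tw st; apply: eq_bigr => i it; apply: kk' => /=.
  by rewrite tw.
by case: t it st {tw} => //= p t -> ->.
Qed.

Lemma alt_sum_morph (V V' : nmodType) (phi : V -> V') w k :
  phi 0 = 0 -> {morph phi : x y / x + y} ->
  phi (alt_sum w k) = alt_sum w (fun t => phi (k t)).
Proof.
move=> phi0 phiD; elim: w k => //= g w ih k; rewrite ih.
by apply: eq_alt_sum => t _ _; rewrite (big_morph phi phiD phi0).
Qed.

Lemma alt_sumD (V : nmodType) w (k k' : seq ('I_N * L) -> V) :
  alt_sum w (fun t => k t + k' t) = alt_sum w k + alt_sum w k'.
Proof.
elim: w k k' => //= g w ih k k'; rewrite -ih.
by apply: eq_alt_sum => t _ _; rewrite big_split.
Qed.

Lemma alt_sumZ (R : nzRingType) (V : lmodType R) w (a : R)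
    (k : seq ('I_N * L) -> V) :
  alt_sum w (fun t => a *: k t) = a *: alt_sum w k.
Proof.
rewrite (alt_sum_morph (phi := fun v => a *: v)) ?scaler0// => x y.
exact: scalerDr.
Qed.

Lemma card_may_precede t :
  #|[pred i | may_precede i t]| = if nilp t then N else N.-1.
Proof.
case: t => [|p t] /=; first by rewrite card_ord.
by rewrite -[in RHS](card_ord N) -(cardC1 p.1).
Qed.

End alternating_sums.

(** * Symmetrised words in the free product *)

Section free_product_words.
Context d (T : measurableType d) (R : realType).
Context (P : {measure set T -> \bar R}) (N : nat) (K : free_product_space P N).
Hypothesis P1 : P setT = 1%E.
Implicit Types (f g h u : T -> R) (w : seq (T -> R)).
Implicit Types (t : seq ('I_N * (T -> R))).

Local Notation L2 := (Lfun P 2%:E).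
Local Notation mean g := (Rintegral P setT g).
Local Notation c := (Defs.center P).
Local Notation tensor := (free_tensor K).

Lemma Lfun2_integrable g : g \in L2 -> P.-integrable setT (EFin \o g).
Proof.
by move=> g2; apply/Lfun1_integrable; apply: Lfun_subset12 g2; rewrite P1.
Qed.

Lemma cst1_Lfun2 : cst 1 \in L2.
Proof.
apply: Lfun2P => //=.
by under eq_integral do rewrite expr1n; rewrite integral_cst// P1 mul1e ltry.
Qed.

Lemma mean_subZ f g r : f \in L2 -> g \in L2 ->
  mean (fun x => f x - r * g x) = mean f - r * mean g.
Proof. by move=> f2 g2; apply: Rintegral_subZ; exact: Lfun2_integrable. Qed.

Lemma centerE g : c g = (fun x => g x - mean g * cst 1 x).
Proof. by apply/funext => x; rewrite /= mulr1. Qed.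

Lemma center_Lfun2 g : g \in L2 -> c g \in L2.
Proof.
by move=> g2; rewrite centerE; apply: Lfun2_subZ => //; exact: cst1_Lfun2.
Qed.

Lemma mean_center g : g \in L2 -> mean (c g) = 0.
Proof.
move=> g2; rewrite centerE mean_subZ//; last exact: cst1_Lfun2.
by rewrite Rintegral_cst// P1 mul1r mulr1 subrr.
Qed.

Lemma centered_center g : g \in L2 -> L2_centered P (c g).
Proof. by move=> g2; split; [exact: center_Lfun2|exact: mean_center]. Qed.

Lemma mul_center u g : u \* c g = (fun x => (u \* g) x - mean g * u x).
Proof.
by apply/funext => x /=; rewrite /Defs.center mulrBr (mulrC (u x) (mean g)).
Qed.

Lemma mean_mul_center u g : u \in L2 -> u \* g \in L2 ->
  mean (u \* c g) = mean (u \* g) - mean g * mean u.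
Proof. by move=> u2 ug2; rewrite mul_center mean_subZ. Qed.

(** Multiplying a centered letter by [u] and centering again produces the letter
    [u \* g] up to the multiple [mean g] of the letter [u]: this is the origin of
    the [swap] weight. *)
Lemma center_mul_center u g : u \in L2 -> u \* g \in L2 ->
  c (u \* c g) = (fun x => c (u \* g) x - mean g * c u x).
Proof.
move=> u2 ug2; apply/funext => x; rewrite /Defs.center.
have /= -> := mean_mul_center u2 ug2.
by rewrite /Defs.center /=; lra.
Qed.

Lemma alternating_cons i g t : alternating_word P ((i, g) :: t) <->
  [/\ may_precede i t, L2_centered P g & alternating_word P t].
Proof.
split=> [[/= st ct]|[it cg [st ct]]].
  split; first by case: t st {ct} => //= p t /andP[].
    by apply: (ct (i, g)); rewrite inE eqxx.
  split; first exact: path_sorted st.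
  by move=> p pt; apply: ct; rewrite inE pt orbT.
split; first by case: t it st {ct} => //= p t -> ->.
by move=> p; rewrite inE => /predU1P[->//|]; exact: ct.
Qed.

(** The space only specifies inner products of simple tensors.  These are linear
    in the first letter, so the difference of the two sides is orthogonal to
    every simple tensor with the same indices and tail, hence to itself. *)
Lemma free_tensor_subZ i f g h r t :
  alternating_word P ((i, f) :: t) -> L2_centered P g -> L2_centered P h ->
  f = (fun x => g x - r * h x) ->
  tensor ((i, f) :: t) = tensor ((i, g) :: t) - r *: tensor ((i, h) :: t).
Proof.
move=> ft cg ch fE; have [it cf at_] := (alternating_cons _ _ _).1 ft.
have dotE a b : L2_centered P a -> L2_centered P b ->
    hdot (tensor ((i, a) :: t)) (tensor ((i, b) :: t)) =
    L2dot P a b * \prod_(p <- zip (unzip2 t) (unzip2 t)) L2dot P p.1 p.2.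
  move=> ca cb; rewrite free_tensor_dot; try exact/alternating_cons.
  by rewrite /= eqxx big_cons.
apply/eqP; rewrite -subr_eq0; apply/eqP/hdot_eq0.
set v := (X in hdot X X).
have v0 b : L2_centered P b -> hdot v (tensor ((i, b) :: t)) = 0.
  move=> cb; rewrite /v !hdotBl hdotZl !dotE// fE L2dot_subl; first by lra.
  - by case: cg.
  - by case: ch.
  - by case: cb.
by rewrite {2}/v !hdotBr hdotZr !v0// mulr0 !subr0.
Qed.

(** The vector sum, over [i_1 <> i_2 <> ... <> i_m], of the simple tensors with
    letters [(i_1, c g_1) ... (i_m, c g_m)]; the span of these vectors is invariant
    under the sum over [i] of the operators [M i]. *)
Definition free_word w : K := alt_sum [seq c g | g <- w] tensor.

Definition free_weights : step_weights R T := {|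
  loop0 := fun u => N%:R * mean u ;
  loop := fun u => N.-1%:R * mean u ;
  swap := fun g => mean g ;
  contract := fun b u g =>
    (if b then N else N.-1)%:R * (mean (u \* g) - mean g * mean u)
|}.

Variable good : set (T -> R).
Hypothesis good_Lfun2 : forall g, good g -> g \in L2.
Hypothesis goodM : forall u g, good u -> good g -> good (u \* g).

Lemma alternating_centered w t : good_word good w ->
  unzip2 t = [seq c g | g <- w] -> sorted (fun p q => p.1 != q.1) t ->
  alternating_word P t.
Proof.
move=> gw tw st; split=> // p pt.
have : p.2 \in [seq c g | g <- w] by rewrite -tw; exact: map_f.
by move=> /mapP[g gg ->]; apply/centered_center/good_Lfun2/gw.
Qed.

Lemma dot_free_word_vacuum w : good_word good w ->
  hdot (free_word w) (free_word [::]) = (nilp w)%:R.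
Proof.
move=> gw; rewrite /free_word /= hdotC.
rewrite (alt_sum_morph (phi := fun v => hdot (tensor [::]) v)); last 2 first.
- by rewrite hdotC hdot0l.
- by move=> x y; exact: hdotDr.
have dot0 t : alternating_word P t ->
    hdot (tensor [::]) (tensor t) = (nilp t)%:R.
  move=> at_; rewrite free_tensor_dot//.
  by case: t at_ => [|p t] _ /=; rewrite ?big_nil.
case: w gw => [_|g w gw]; first exact: dot0.
transitivity (alt_sum [seq c g | g <- g :: w]
   (fun _ : seq ('I_N * (T -> R)) => (0 : R) *: 0 : R^o)).
  apply: eq_alt_sum => t tw st.
  rewrite dot0; last exact: (alternating_centered gw tw st).
  by case: t tw {st} => //= p t _; rewrite scaler0.
by rewrite alt_sumZ scale0r.
Qed.

Section step.
Context (u : T -> R) (M : 'I_N -> K -> K).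
Hypothesis gu : good u.
Hypothesis hM : forall i, free_multiplication u i (M i).

Lemma linear_free_sum : linear (free_sum M).
Proof.
move=> a x y; rewrite /free_sum scaler_sumr -big_split /=.
by apply: eq_bigr => i _; have [[-> _] _ _ _] := hM i.
Qed.

(** Among the N operators, only the [i]-th one touches the first letter; the N - 1
    others reproduce the tensor and put the letter [u] in front of it. *)
Lemma free_sum_tensor i g t : good g -> alternating_word P ((i, c g) :: t) ->
  free_sum M (tensor ((i, c g) :: t)) =
    (N.-1%:R * mean u) *: tensor ((i, c g) :: t) +
    \sum_(j < N | j != i) tensor ((j, c u) :: (i, c g) :: t) +
    tensor ((i, c (u \* g)) :: t) - mean g *: tensor ((i, c u) :: t) +
    (mean (u \* g) - mean g * mean u) *: tensor t.
Proof.
move=> gg at_; have u2 := good_Lfun2 gu.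
have ug2 := good_Lfun2 (goodM gu gg).
have [it _ at'] := (alternating_cons _ _ _).1 at_.
rewrite /free_sum (bigD1 i)//= addrC.
have [_ _ _ ->//] := hM i.
have -> : \int[P]_x (u x * c g x) = mean (u \* g) - mean g * mean u.
  exact: mean_mul_center.
rewrite (free_tensor_subZ _ _ _ (center_mul_center u2 ug2)); last 3 first.
- apply/alternating_cons; split=> //; apply: centered_center.
  by rewrite mul_center; exact: Lfun2_subZ.
- exact: centered_center.
- exact: centered_center.
rewrite [X in X + _](_ : _ = (N.-1%:R * mean u) *: tensor ((i, c g) :: t) +
    \sum_(j < N | j != i) tensor ((j, c u) :: (i, c g) :: t)).
  by rewrite -!addrA; congr (_ + (_ + _)); rewrite [LHS]addrC -addrA.
have cardN : #|[pred j | j != i]| = N.-1 by rewrite (cardC1 i) card_ord.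
rewrite -scalerA scaler_nat -cardN -sumr_const.
rewrite -big_split /=; apply: eq_bigr => j ji.
by have [_ _ -> //] := hM j.
Qed.

Lemma free_sum_acts_on_words :
  acts_on_words free_word free_weights good u (free_sum M).
Proof.
split=> [|g w /[dup] ggw /good_word_cons[gg gw]].
  rewrite /free_word /= /free_sum.
  rewrite (eq_bigr (fun i => mean u *: tensor [::] + tensor [:: (i, c u)])).
    by rewrite big_split /= sumr_const card_ord -scaler_nat scalerA.
  by move=> i _; have [_ Mi _ _] := hM i; exact: Mi.
have lM := linear_free_sum.
rewrite {1}/free_word (alt_sum_morph (phi := free_sum M)); last 2 first.
- exact: linear_fun0.
- by move=> x y; exact: linear_funD.
rewrite /free_word /= -!alt_sumZ -!alt_sumD.
rewrite -[- alt_sum _ _]scaleN1r -!alt_sumZ -!alt_sumD.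
apply: eq_alt_sum => t tw st; have at_ := alternating_centered gw tw st.
rewrite scaleN1r.
transitivity (\sum_(i < N | may_precede i t)
   ((N.-1%:R * mean u) *: tensor ((i, c g) :: t) +
    \sum_(j < N | j != i) tensor ((j, c u) :: (i, c g) :: t) +
    tensor ((i, c (u \* g)) :: t) - mean g *: tensor ((i, c u) :: t) +
    (mean (u \* g) - mean g * mean u) *: tensor t)).
  apply: eq_bigr => i it; apply: free_sum_tensor => //.
  by apply/alternating_cons; split=> //; apply/centered_center/good_Lfun2.
rewrite !big_split /= sumrN -!scaler_sumr sumr_const card_may_precede.
rewrite (_ : nilp t = nilp w).
  by rewrite -[tensor t *+ _]scaler_nat scalerA; congr (_ + _ *: _); exact: mulrC.
by rewrite /nilp -(size_map c w) -tw size_map.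
Qed.

End step.
End free_product_words.

(** * Words in the full Fock space *)

Section shift.
Context (R : realType) (T : Type).

Definition shift_weights (e : (T -> R) -> R) (c : step_weights R T) := {|
  loop0 := fun u => loop0 c u + e u ;
  loop := fun u => loop c u + e u ;
  swap := swap c ;
  contract := contract c |}.

Lemma acts_on_words_shift (V : lmodType R) (W : seq (T -> R) -> V)
    c good u B e :
  acts_on_words W c good u B ->
  acts_on_words W (shift_weights e c) good u (fun v => B v + e u *: v).
Proof.
move=> [B0 Bg]; split=> [|g w gw]; first by rewrite B0 /= scalerDl addrAC.
rewrite Bg//= scalerDl -!addrA; congr (_ + _).
by rewrite [RHS]addrC -!addrA.
Qed.

Lemma linear_shift (V : lmodType R) (B : V -> V) a :
  linear B -> linear (fun v => B v + a *: v).
Proof.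
move=> lB b x y; rewrite lB !scalerDr !scalerA addrACA.
by rewrite (mulrC a).
Qed.

End shift.

Section fock_words.
Context d (T : measurableType d) (R : realType).
Context (mu : {measure set T -> \bar R}) (F : full_fock_space mu).
Implicit Types (g u : T -> R) (w : seq (T -> R)).

Local Notation L2 := (Lfun mu 2%:E).
Local Notation tensor := (fock_tensor F).

Definition fock_weights : step_weights R T := {|
  loop0 := fun=> 0 ;
  loop := fun=> 0 ;
  swap := fun=> 0 ;
  contract := fun=> L2dot mu |}.

Variable good : set (T -> R).
Hypothesis good_Lfun2 : forall g, good g -> g \in L2.

Lemma sub_good_word w : good_word good w -> {subset w <= L2}.
Proof. by move=> gw g /gw /good_Lfun2. Qed.

Lemma dot_fock_tensor_vacuum w : good_word good w ->
  hdot (tensor w) (tensor [::]) = (nilp w)%:R.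
Proof.
move=> /sub_good_word wL2; rewrite fock_tensor_dot//.
by case: w wL2 => [|g w] _ /=; rewrite ?big_nil.
Qed.

Context (u : T -> R) (ap a0 am : F -> F).
Hypothesis gu : good u.
Hypothesis hap : creation_operator u ap.
Hypothesis ham : adjoint_of ap am.
Hypothesis ha0 : neutral_operator (multiplication u) a0.

(** The annihilation operator is only known as an adjoint; its values on simple
    tensors follow from their totality. *)
Lemma adjoint_vacuum : am (tensor [::]) = 0.
Proof.
apply: (dense_orthogonal_eq (@fock_tensor_total _ _ _ _ F)) => _ [w wL2 <-].
have [_ ->] := ham; have [_ ->//] := hap.
rewrite fock_tensor_dot//=; last first.
  by move=> g; rewrite inE => /predU1P[->|/wL2//]; exact: good_Lfun2.
by rewrite hdot0l.
Qed.

Lemma adjoint_cons g w : g \in L2 -> {subset w <= L2} ->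
  am (tensor (g :: w)) = L2dot mu u g *: tensor w.
Proof.
move=> g2 wL2.
have consL2 h v : h \in L2 -> {subset v <= L2} -> {subset h :: v <= L2}.
  by move=> h2 vL2 k; rewrite inE => /predU1P[->|/vL2].
apply: (dense_orthogonal_eq (@fock_tensor_total _ _ _ _ F)) => _ [v vL2 <-].
have [_ ->] := ham; have [_ ->//] := hap.
have u2 := good_Lfun2 gu.
rewrite hdotZl !fock_tensor_dot//; try exact: consL2.
rewrite /= eqSS big_cons /=; case: ifP => _; last by rewrite mulr0.
by congr (_ * _); rewrite /L2dot; under eq_Rintegral do rewrite mulrC.
Qed.

Lemma fock_acts_on_words :
  acts_on_words tensor fock_weights good u (fun v => ap v + a0 v + am v).
Proof.
have [_ apE] := hap; have [_ a00 a0E] := ha0.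
split=> [|g w /good_word_cons[gg /sub_good_word wL2]] /=.
  by rewrite apE// a00 adjoint_vacuum !addr0 scale0r add0r.
have g2 := good_Lfun2 gg.
rewrite apE; last by move=> k; rewrite inE => /predU1P[->|/wL2].
by rewrite a0E// adjoint_cons// !scale0r subr0 add0r.
Qed.

Lemma linear_fock : linear (fun v => ap v + a0 v + am v).
Proof.
have [[lp _] _] := hap; have [[l0 _] _ _] := ha0; have [[lm _] _] := ham.
move=> a x y; rewrite lp l0 lm !scalerDr.
by rewrite (addrACA (a *: ap x)) (addrACA (a *: ap x + _)).
Qed.

End fock_words.

(** * Integrals over restricted and product measures *)

Section normalized_restriction.
Context d (T : measurableType d) (R : realType).
Context (mu : {measure set T -> \bar R}) (E : set T) (mE : measurable E).
Implicit Types f : T -> R.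

Local Notation P := (normalized_restriction mu mE).

Lemma ge0_integral_normalized_restriction (f : T -> \bar R) :
  measurable_fun setT f -> (forall x, 0 <= f x)%E ->
  (\int[P]_x f x = ((fine (mu E))^-1)%:E * \int[mu]_(x in E) f x)%E.
Proof.
move=> mf f0; rewrite ge0_integral_mscale//; congr (_ * _)%E.
rewrite -(setUv E) ge0_integral_setU//; last 3 first.
- exact: measurableC.
- by rewrite setUv.
- exact/disj_setPCl.
rewrite [X in (_ + X)%E]null_set_integral ?adde0.
- by apply: eq_measure_integral => A mA AE; rewrite /= /mrestr setIidl.
- exact: measurableC.
- exact: measurable_funTS.
- by rewrite /= /mrestr setICl measure0.
Qed.

Lemma Rintegral_normalized_restriction f : measurable_fun setT f ->
  mu.-integrable E (EFin \o f) ->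
  \int[P]_x f x = (fine (mu E))^-1 * \int[mu]_(x in E) f x.
Proof.
move=> mf fi; rewrite /Rintegral integralE [X in _ = _ * fine X]integralE.
have mF : measurable_fun setT (EFin \o f) by exact/measurable_EFinP.
have fp : (\int[mu]_(x in E) (EFin \o f)^\+ x)%E \is a fin_num.
  exact: (integrable_fin_num mE (integrable_funepos mE fi)).
have fn : (\int[mu]_(x in E) (EFin \o f)^\- x)%E \is a fin_num.
  exact: (integrable_fin_num mE (integrable_funeneg mE fi)).
rewrite !ge0_integral_normalized_restriction//.
- by rewrite -muleBr ?fin_num_adde_defl ?fin_numN// fineM// fin_numB fp fn.
- exact: measurable_funeneg.
- exact: measurable_funepos.
Qed.

Lemma normalized_restriction_setT : (0 < mu E < +oo)%E -> P setT = 1%E.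
Proof.
move=> /andP[E0 Eoo].
rewrite /normalized_restriction /= /mscale /= /mrestr setTI.
rewrite -[X in (_ * X)%E]fineK ?ge0_fin_numE// -EFinM mulVf//.
by rewrite gt_eqF// fine_gt0// E0.
Qed.

End normalized_restriction.

Section product_integrals.
Context d1 d2 (T1 : measurableType d1) (T2 : measurableType d2) (R : realType).
Context (m1 : {sigma_finite_measure set T1 -> \bar R}).
Context (m2 : {sigma_finite_measure set T2 -> \bar R}).
Context (a : T1 -> R) (b : T2 -> R).
Hypothesis ai : m1.-integrable setT (EFin \o a).
Hypothesis bi : m2.-integrable setT (EFin \o b).

Lemma measurable_tensor_fun (f : T1 -> R) (g : T2 -> R) :
  measurable_fun setT f -> measurable_fun setT g ->
  measurable_fun setT (fun z : T1 * T2 => f z.1 * g z.2).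
Proof.
by move=> mf mg; apply: measurable_funM; apply: measurableT_comp.
Qed.

Lemma integrable_tensor_fun :
  (m1 \x m2)%E.-integrable setT (EFin \o (fun z => a z.1 * b z.2)).
Proof.
have /integrableP[/measurable_EFinP ma aoo] := ai.
have /integrableP[/measurable_EFinP mb boo] := bi.
apply/integrable12ltyP.
  by apply/measurable_EFinP; exact: measurable_tensor_fun.
under eq_integral => x _.
  under eq_integral do rewrite /= normrM EFinM.
  rewrite ge0_integralZl//; last by apply/measurable_EFinP/measurableT_comp.
  over.
rewrite /= ge0_integralZr//; last 2 first.
- by apply/measurable_EFinP/measurableT_comp.
- exact: integral_ge0.
rewrite lte_mul_pinfty//; first exact: integral_ge0.
by rewrite ge0_fin_numE//; exact: integral_ge0.
Qed.

Lemma Rintegral_tensor_fun :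
  \int[(m1 \x m2)%E]_z (a z.1 * b z.2) = (\int[m1]_x a x) * (\int[m2]_y b y).
Proof.
have bfin := integrable_fin_num measurableT bi.
rewrite /Rintegral -(integral12_prod_meas1 integrable_tensor_fun) /fubini_F.
transitivity (fine (\int[m1]_x ((a x)%:E * (fine (\int[m2]_y (b y)%:E))%:E)%E)).
  by congr fine; apply: eq_integral => x _; rewrite fineK// -integralZl.
rewrite integralZr// fineM//.
exact: (integrable_fin_num measurableT ai).
Qed.

End product_integrals.

Lemma Lfun2_tensor_fun d1 d2 (T1 : measurableType d1) (T2 : measurableType d2)
    (R : realType) (m1 : {sigma_finite_measure set T1 -> \bar R})
    (m2 : {sigma_finite_measure set T2 -> \bar R}) (a : T1 -> R) (b : T2 -> R) :
  measurable_fun setT a -> measurable_fun setT b ->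
  m1.-integrable setT (EFin \o (fun x => a x ^+ 2)) ->
  m2.-integrable setT (EFin \o (fun y => b y ^+ 2)) ->
  (fun z => a z.1 * b z.2) \in Lfun (m1 \x m2)%E 2%:E.
Proof.
move=> ma mb a2i b2i; apply: Lfun2P; first exact: measurable_tensor_fun.
under eq_integral do rewrite exprMn.
exact: (integrable_lty measurableT (integrable_tensor_fun a2i b2i)).
Qed.

Lemma nondecreasing_subset (T : Type) (F : nat -> set T) :
  (forall n, F n `<=` F n.+1) ->
  forall m n, (m <= n)%N -> F m `<=` F n.
Proof.
move=> ndF m; elim=> [|n ih]; first by rewrite leqn0 => /eqP ->.
rewrite leq_eqVlt => /predU1P[->//|/ih mn].
exact: subset_trans mn (ndF n).
Qed.

Lemma cvg_Rintegral_exhaustion d (T : measurableType d) (R : realType)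
    (mu : {measure set T -> \bar R}) (E : nat -> set T) (g : T -> R) :
  (forall n, measurable (E n)) -> (forall n, E n `<=` E n.+1) ->
  \bigcup_n E n = setT -> mu.-integrable setT (EFin \o g) ->
  \int[mu]_(x in E n) g x @[n --> \oo] --> \int[mu]_x g x.
Proof.
move=> mE ndE EU gi.
have [] := @dominated_convergence _ _ _ mu setT measurableT
  (fun n => (EFin \o g) \_ (E n)) (EFin \o g) (abse \o (EFin \o g)).
- move=> n; apply/(measurable_restrictT _ (mE n)).
  apply: measurable_funTS; exact: measurable_int gi.
- exact: measurable_int gi.
- apply: aeW => x _; have : (\bigcup_n E n) x by rewrite EU.
  move=> [m _ Emx]; apply: cvg_near_cst; exists m => //= n mn.
  by rewrite patchE mem_set//; exact: (nondecreasing_subset ndE mn).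
- exact: integrable_abse.
- apply: aeW => x n _; rewrite patchE.
  by case: ifP => //= _; rewrite normr0 lee_fin.
move=> _ _.
under eq_fun do rewrite -integral_mkcond.
move=> gE; apply/fine_cvg; rewrite fineK//.
exact: (integrable_fin_num measurableT gi).
Qed.

(** * Bounded functions with compact support *)

Section sigma_finite.
Context d (T : measurableType d) (R : realType).

(** Fubini needs the bundled structure; the equality is between measures, so that
    a measure occurring in the type of other objects can be replaced. *)
Lemma sigma_finite_measure_of (m : {measure set T -> \bar R}) :
  sigma_finite setT m ->
  exists m' : {sigma_finite_measure set T -> \bar R}, m = m'.
Proof.
move: m => [f [cls1 cls2]] sf.
pose m : {measure set T -> \bar R} := Measure.Pack (Measure.Class cls2).
pose b := @Measure_isSigmaFinite.Build _ _ _ m sf.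
pose m' : {sigma_finite_measure set T -> \bar R} :=
  HB.pack (Measure.sort m) b.
by exists m'.
Qed.

End sigma_finite.

Lemma measurable_rval (R : realType) :
  measurable_fun setT (@rval R : borel (Rstar R) -> R).
Proof.
apply: (measurability _ (RGenOpens.measurableE R)) => _ [_ [a [b ->]] <-].
rewrite setTI; apply: sub_sigma_algebra.
apply: (@open_comp _ _ (@rval R : Rstar R -> R)); last exact: interval_open.
by move=> s _; exact: initial_continuous.
Qed.

Section bounded_compact_support.
Context (R : realType) (X : ptopologicalType).
Implicit Types f g : X -> R.

Lemma bounded_compact_supportM f g :
  bounded_compact_support f -> bounded_compact_support g ->
  bounded_compact_support (f \* g).
Proof.
move=> [mf [C fC] cf] [mg [D gD] cg]; split.
- exact: measurable_funM.
- by exists (C * D) => x; rewrite normrM ler_pM.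
- apply: (subclosed_compact (@closed_closure _ _) cf).
  by apply: closure_subset => x /=; apply: contra_neq => ->; rewrite mul0r.
Qed.

Lemma measurable_support f : bounded_compact_support f ->
  measurable ([set x | f x != 0] : set (borel X)).
Proof.
move=> [mf _ _].
rewrite (_ : [set _ | _] = setT `&` (f : borel X -> R) @^-1` [set~ 0]).
  by apply: mf => //; exact: measurableC.
by rewrite setTI; apply/seteqP; split=> x /= /eqP.
Qed.

Lemma integrable_bounded_compact_support
    (sigma : {measure set (borel X) -> \bar R}) f :
  radon sigma -> bounded_compact_support f ->
  sigma.-integrable setT (EFin \o f).
Proof.
move=> sr bf; have mS := measurable_support bf.
have [mf [C fC] cf] := bf.
have -> : EFin \o f = (EFin \o f) \_ [set x | f x != 0].
  apply/funext => x; rewrite patchE; case: ifPn => //.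
  by rewrite notin_setE /= => /negP/negPn/eqP ->.
apply/(integrable_mkcond _ mS).
apply: measurable_bounded_integrable => //.
- by apply: sr; split.
- exact: measurable_funTS.
- exists C; split; first exact: num_real.
  by move=> M CM x _ /=; exact: le_trans (fC x) (ltW CM).
Qed.

End bounded_compact_support.

Section indicator.
Context d (T : measurableType d) (R : realType).
Context (mu : {measure set T -> \bar R}) (A : set T).
Hypothesis mA : measurable A.

Lemma Rintegral_indicator : \int[mu]_x \1_A x = fine (mu A).
Proof. by rewrite /Rintegral integral_indic// setIT. Qed.

Lemma integrable_indicator : (mu A < +oo)%E ->
  mu.-integrable setT (EFin \o \1_A).
Proof.
move=> Aoo; apply/integrableP; split; first exact/measurable_EFinP.
under eq_integral do rewrite /= ger0_norm//.
by rewrite integral_indic// setIT.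
Qed.

End indicator.

Lemma weighted_amgm (R : realFieldType) (s a : R) : 0 < s ->
  a <= s^-1 / 2 + s / 2 * a ^+ 2.
Proof.
move=> s0; rewrite -subr_ge0.
have -> : s^-1 / 2 + s / 2 * a ^+ 2 - a = s / 2 * (a - s^-1) ^+ 2.
  have sV : s * s^-1 = 1 by rewrite mulfV// gt_eqF.
  have sVa : s * s^-1 * a = a by rewrite sV mul1r.
  have sVV : s * s^-1 * s^-1 = s^-1 by rewrite sV mul1r.
  by lra.
by rewrite mulr_ge0 ?sqr_ge0// divr_ge0// ltW.
Qed.

(** * The letters that occur in the moments *)

Section levy_letters.
Context (R : realType) (X : ptopologicalType).
Context (sigma : {sigma_finite_measure set (borel X) -> \bar R}).
Context (nu : {sigma_finite_measure set (borel (Rstar R)) -> \bar R}).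
Hypothesis sigma_radon : radon sigma.
Hypothesis nu_bounded :
  exists2 r : R, 0 < r & nu [set s | r < `|rval s|] = 0%E.

Local Notation mu := (sigma \x nu)%E.

(** As [nu] lives on a bounded set, higher moments are controlled by lower ones. *)
Lemma integrable_rval_exprD p k :
  (\int[nu]_s (`|rval s| ^+ p)%:E < +oo)%E ->
  nu.-integrable setT (EFin \o (fun s => rval s ^+ (p + k))).
Proof.
move=> poo; have [r r0 nur] := nu_bounded.
have ms q : measurable_fun setT (fun s : borel (Rstar R) => rval s ^+ q).
  by apply: measurable_funX; exact: measurable_rval.
have mns q : measurable_fun setT (fun s : borel (Rstar R) => `|rval s| ^+ q).
  apply: measurable_funX; apply: measurableT_comp => //.
  exact: measurable_rval.
apply/integrableP; split; first exact/measurable_EFinP.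
apply: (@le_lt_trans _ _ (\int[nu]_s ((r ^+ k)%:E * (`|rval s| ^+ p)%:E))%E).
  apply: ae_ge0_le_integral => //.
  - by apply/measurable_EFinP; apply: measurableT_comp.
  - by move=> s _; rewrite -EFinM lee_fin mulr_ge0// exprn_ge0// ltW.
  - by apply/measurable_EFinP; apply: measurable_funM.
  exists [set s | r < `|rval s|]; split => //.
    have mn : measurable_fun setT (fun s : borel (Rstar R) => `|rval s|).
      by have := mns 1; under eq_fun do rewrite expr1.
    rewrite (_ : [set _ | _] = setT `&`
        (fun s : borel (Rstar R) => `|rval s|) @^-1` `]r, +oo[).
      exact: mn.
    by apply/seteqP; split => s; rewrite /= in_itv/= andbT// => -[].
  move=> s; apply: contra_notT => /=; rewrite -leNgt => sr _.
  rewrite normrX exprD mulrC lee_fin ler_wpM2r ?exprn_ge0//.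
  by rewrite lerXn2r ?nnegrE// ltW.
rewrite ge0_integralZl//.
- by rewrite lte_mul_pinfty// lee_fin exprn_ge0// ltW.
- exact/measurable_EFinP.
- by rewrite lee_fin exprn_ge0// ltW.
Qed.

(** The multiplicative class generated by the functions [otimes_id f].  Apart from
    the generators themselves, its elements vanish at least quadratically at
    [s = 0], which is why a second moment of [nu] makes them integrable. *)
Definition levy_letter (g : borel X * borel (Rstar R) -> R) : Prop :=
  exists (f : X -> R) (m : nat), bounded_compact_support f /\
    g = fun z => f z.1 * rval z.2 ^+ m.+1.

Lemma levy_letter_otimes_id f :
  bounded_compact_support f -> levy_letter (otimes_id f).
Proof. by move=> bf; exists f, 0; split. Qed.

Lemma levy_letterM u g : levy_letter u -> levy_letter g -> levy_letter (u \* g).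
Proof.
move=> [f [m [bf ->]]] [h [n [bh ->]]]; exists (f \* h), (m + n).+1.
split; first exact: bounded_compact_supportM.
by apply/funext => z /=; rewrite mulrACA -exprD addSn addnS.
Qed.

Lemma measurable_levy_letter g : levy_letter g -> measurable_fun setT g.
Proof.
move=> [f [m [[mf _ _] ->]]].
apply: (@measurable_tensor_fun _ _ (borel X) (borel (Rstar R)) R f
  (fun s => rval s ^+ m.+1) mf).
by apply: measurable_funX; exact: measurable_rval.
Qed.

Section square_integrable_levy_letters.
Hypothesis nu_sqr : (\int[nu]_s (rval s ^+ 2)%:E < +oo)%E.

Lemma levy_letter_Lfun2 g : levy_letter g -> g \in Lfun mu 2%:E.
Proof.
move=> [f [m [bf ->]]].
apply: (@Lfun2_tensor_fun _ _ (borel X) (borel (Rstar R)) R sigma nu f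
  (fun s => rval s ^+ m.+1)).
- by case: bf.
- by apply: measurable_funX; exact: measurable_rval.
- exact: (integrable_bounded_compact_support sigma_radon
    (bounded_compact_supportM bf bf)).
under eq_fun do rewrite -exprM muln2 doubleS.
apply: (@integrable_rval_exprD 2); move: nu_sqr.
by under eq_integral do rewrite -real_normK ?num_real//.
Qed.

Lemma levy_letterM_integrable u g : levy_letter u -> levy_letter g ->
  mu.-integrable setT (EFin \o (u \* g)).
Proof.
move=> lu lg; apply/Lfun1_integrable/Lfun2_mul_Lfun1.
  exact: levy_letter_Lfun2.
exact: levy_letter_Lfun2.
Qed.

(** A Cauchy-Schwarz estimate: [g] vanishes outside of [S `*` setT], where
    [S] is the support of its first factor, and [S `*` B] has measure
    [sigma S * nu B] whatever [A] is.  It is needed because under a second moment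
    condition alone the integral of a generator over [A `*` B] may be unbounded.  In
    place of Cauchy-Schwarz, [weighted_amgm] is integrated with the weight
    [s = Num.sqrt (nu B)], which balances its two terms. *)
Lemma levy_letter_bound g : levy_letter g ->
  exists2 C : R, 0 <= C & forall A B, borel_relcompact A ->
    borel_relcompact B -> (0 < nu B < +oo)%E ->
    mu.-integrable (A `*` B) (EFin \o g) /\
    `|\int[mu]_(z in A `*` B) g z| <= C * Num.sqrt (fine (nu B)).
Proof.
move=> lg; have [f [m [bf gE]]] := lg.
pose S : set (borel X) := [set x | f x != 0].
have mS : measurable S := measurable_support bf.
have Soo : (sigma S < +oo)%E by apply: sigma_radon; split=> //; case: bf.
have g2i := Lfun2_integrable_sqr (levy_letter_Lfun2 lg).
pose G := \int[mu]_z (g z ^+ 2).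
have G0 : 0 <= G by apply: Rintegral_ge0 => z _; exact: sqr_ge0.
exists ((fine (sigma S) + G) / 2).
  by rewrite divr_ge0// addr_ge0// fine_ge0.
move=> A B cA cB /andP[B0 Boo].
have mB : measurable (B : set (borel (Rstar R))) by case: cB.
have mE := borel_relcompact_setX cA cB.
set s := Num.sqrt _.
have nB0 : 0 < fine (nu B) by rewrite fine_gt0// B0.
have s0 : 0 < s by rewrite sqrtr_gt0.
pose h (z : borel X * borel (Rstar R)) : R := \1_S z.1 * \1_B z.2.
have hi : mu.-integrable setT (EFin \o h).
  by apply: integrable_tensor_fun; apply: integrable_indicator.
have hE : \int[mu]_z h z = fine (sigma S) * fine (nu B).
  rewrite Rintegral_tensor_fun; try exact: integrable_indicator.
  by rewrite !Rintegral_indicator.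
pose k z := s^-1 / 2 * h z + s / 2 * g z ^+ 2.
have k1i : mu.-integrable setT (EFin \o (fun z => s^-1 / 2 * h z)).
  exact: (integrableZl measurableT _ hi).
have k2i : mu.-integrable setT (EFin \o (fun z => s / 2 * g z ^+ 2)).
  exact: (integrableZl measurableT _ g2i).
have ki : mu.-integrable setT (EFin \o k).
  exact: (integrableD measurableT k1i k2i).
have gk z : `|(g \_ (A `*` B)) z| <= k z.
  have k0 : 0 <= k z.
    rewrite addr_ge0// mulr_ge0 ?divr_ge0 ?invr_ge0 ?sqr_ge0 ?(ltW s0)//.
    by rewrite mulr_ge0.
  rewrite patchE; case: ifPn => [|_]; last by rewrite normr0.
  rewrite inE => -[_ Bz].
  have [fz0|fz0] := eqVneq (f z.1) 0.
    by rewrite gE fz0 mul0r normr0.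
  rewrite /k /h !indicE !mem_set// mul1r mulr1.
  by rewrite -[g z ^+ 2]real_normK ?num_real//; exact: weighted_amgm.
have gEi : mu.-integrable setT (EFin \o (g \_ (A `*` B))).
  apply: le_integrable ki => //.
    apply/measurable_EFinP/(measurable_restrictT _ mE)/measurable_funTS.
    exact: measurable_levy_letter.
  by move=> z _; rewrite /= lee_fin (le_trans (gk z))// ler_norm.
split.
  by apply/(integrable_mkcond _ mE); rewrite restrict_EFin.
rewrite Rintegral_mkcond.
apply: le_trans (le_normr_Rintegral measurableT gEi) _.
apply: (@le_trans _ _ (\int[mu]_z k z)).
  by apply: le_Rintegral => //; exact: integrable_norm.
rewrite RintegralD// !RintegralZl// hE -/G.
have -> : fine (nu B) = s * s by rewrite -expr2 sqr_sqrtr// ltW.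
have sVs2 : s^-1 * (s * s) = s by rewrite mulrA mulVf ?mul1r// gt_eqF.
rewrite (_ : _ + _ = (fine (sigma S) * (s^-1 * (s * s)) + s * G) / 2); last lra.
by rewrite sVs2; lra.
Qed.
End square_integrable_levy_letters.
End levy_letters.

(** * Limits of the weights *)

Section exhaustion.
Context (R : realType) (X : ptopologicalType).
Context (sigma : {sigma_finite_measure set (borel X) -> \bar R}).
Context (nu : {sigma_finite_measure set (borel (Rstar R)) -> \bar R}).
Context (Lambda : nat -> set X) (Delta : nat -> set (Rstar R)).
Context (N : nat -> nat).
Hypothesis sigma_radon : radon sigma.
Hypothesis nu_bounded :
  exists2 r : R, 0 < r & nu [set s | r < `|rval s|] = 0%E.
Hypothesis nu_sqr : (\int[nu]_s (rval s ^+ 2)%:E < +oo)%E.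
Hypothesis sigma_infinite : sigma setT = +oo%E.
Hypothesis hLambda : forall n, borel_relcompact (Lambda n).
Hypothesis hDelta : forall n, borel_relcompact (Delta n).
Hypothesis Lambda_nondecreasing : forall n, Lambda n `<=` Lambda n.+1.
Hypothesis Delta_nondecreasing : forall n, Delta n `<=` Delta n.+1.
Hypothesis Lambda_cover : \bigcup_n Lambda n = setT.
Hypothesis Delta_cover : \bigcup_n Delta n = setT.
Hypothesis V_gt0 : forall n, (0 < sigma (Lambda n) * nu (Delta n) < +oo)%E.
Hypothesis N_gt0 : forall n, (0 < N n)%N.
Hypothesis N_lim : (N n)%:R / fine (sigma (Lambda n) * nu (Delta n))%E
             @[n --> \oo] --> (1 : R).

Local Notation mu := (sigma \x nu)%E.
Local Notation letter := (@levy_letter R X).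
Local Notation E n := (Lambda n `*` Delta n).
Local Notation P n := (normalized_restriction mu
  (borel_relcompact_setX (hLambda n) (hDelta n))).
Local Notation mean n g := (Rintegral (P n) setT g).
Local Notation V n := (fine (sigma (Lambda n) * nu (Delta n))%E).

Let mLambda n : measurable (Lambda n : set (borel X)).
Proof. by case: (hLambda n). Qed.

Let mDelta n : measurable (Delta n : set (borel (Rstar R))).
Proof. by case: (hDelta n). Qed.

Let muE n : mu (E n) = (sigma (Lambda n) * nu (Delta n))%E.
Proof. exact: product_measure1E. Qed.

Let sigma_fin n : (0 < sigma (Lambda n) < +oo)%E.
Proof.
rewrite sigma_radon// andbT lt0e measure_ge0 andbT.
by apply: contraTneq (V_gt0 n) => ->; rewrite mul0e ltxx.
Qed.

Let nu_fin n : (0 < nu (Delta n) < +oo)%E.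
Proof.
have /andP[s0 soo] := sigma_fin n; have /andP[v0 voo] := V_gt0 n.
rewrite lt0e measure_ge0 andbT; apply/andP; split.
  by apply: contraTneq v0 => ->; rewrite mule0 ltxx.
by rewrite ltey; apply: contraTneq voo => ->; rewrite gt0_muley.
Qed.

Let VE n : V n = fine (sigma (Lambda n)) * fine (nu (Delta n)).
Proof.
have /andP[s0 soo] := sigma_fin n; have /andP[n0 noo] := nu_fin n.
by rewrite fineM// ge0_fin_numE.
Qed.

Let sigma_pos n : 0 < fine (sigma (Lambda n)).
Proof. exact: fine_gt0. Qed.

Let nu_pos n : 0 < fine (nu (Delta n)).
Proof. exact: fine_gt0. Qed.

Let leDelta n : fine (nu (Delta 0%N)) <= fine (nu (Delta n)).
Proof.
have ndD : Delta 0%N `<=` Delta n by exact: nondecreasing_subset.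
have /andP[n0 noo] := nu_fin n; have /andP[m0 moo] := nu_fin 0%N.
by rewrite fine_le ?ge0_fin_numE// le_measure ?inE.
Qed.

Lemma probability_normalized n : P n setT = 1%E.
Proof.
by apply: normalized_restriction_setT; have := V_gt0 n; rewrite -muE.
Qed.

Lemma levy_letter_Lfun2_normalized n g : letter g -> g \in Lfun (P n) 2%:E.
Proof.
move=> lg; have mg := measurable_levy_letter lg.
apply: Lfun2P => //.
rewrite ge0_integral_normalized_restriction//; last 2 first.
- by apply/measurable_EFinP; exact: measurable_funX.
- by move=> z; rewrite lee_fin sqr_ge0.
rewrite lte_mul_pinfty ?lee_fin ?invr_ge0 ?fine_ge0//.
have mE := borel_relcompact_setX (hLambda n) (hDelta n).
have gL2 := levy_letter_Lfun2 sigma_radon nu_bounded nu_sqr lg.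
have g2 := Lfun2_integrable_sqr gL2.
apply: le_lt_trans (integrable_lty measurableT g2).
apply: ge0_subset_integral => //; last by move=> z _; rewrite lee_fin sqr_ge0.
by apply/measurable_EFinP; exact: measurable_funX.
Qed.

Lemma mean_normalized n g : letter g ->
  mean n g = (V n)^-1 * \int[mu]_(z in E n) g z.
Proof.
move=> lg; rewrite -muE Rintegral_normalized_restriction//.
  exact: measurable_levy_letter.
have [C _ bC] := levy_letter_bound sigma_radon nu_bounded nu_sqr lg.
by have [] := bC _ _ (hLambda n) (hDelta n) (nu_fin n).
Qed.

Lemma cvg_inv_sigma : (fine (sigma (Lambda n)))^-1 @[n --> \oo] --> (0 : R).
Proof.
apply/gtr0_cvgV0; first by near=> n; exact: sigma_pos.
apply/cvgryPge => A.
have : sigma (Lambda n) @[n --> \oo] --> +oo%E.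
  rewrite -sigma_infinite -Lambda_cover; apply: nondecreasing_cvg_mu => //.
    exact: bigcup_measurable.
  by apply/nondecreasing_seqP => n; exact/subsetPset.
move=> /cvgeyPge /(_ A); apply: filterS => n.
have /andP[s0 soo] := sigma_fin n.
by rewrite -[X in (_ <= X)%E -> _]fineK ?lee_fin// ge0_fin_numE.
Unshelve. all: by end_near. Qed.

Lemma cvg_bounded_by (a b : nat -> R) (C : R) :
  (forall n, `|a n| <= C * b n) -> b @ \oo --> (0 : R) -> a @ \oo --> (0 : R).
Proof.
move=> ab b0; apply/norm_cvg0P.
apply: (@squeeze_cvgr _ _ _ _ (fun=> 0) (fun n => C * b n)).
- by apply: nearW => n; rewrite /= normr_ge0 ab.
- exact: cvg_cst.
- by rewrite -(mulr0 C); apply: cvgM => //; exact: cvg_cst.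
Qed.

Lemma cvg_mean g : letter g -> mean n g @[n --> \oo] --> (0 : R).
Proof.
move=> lg.
have [C C0 bC] := levy_letter_bound sigma_radon nu_bounded nu_sqr lg.
pose C' := C / Num.sqrt (fine (nu (Delta 0%N))).
apply: (@cvg_bounded_by _ _ C' _ cvg_inv_sigma) => n.
rewrite mean_normalized// VE normrM.
rewrite ger0_norm; last by rewrite invr_ge0 mulr_ge0// ltW.
have [_ gC] := bC _ _ (hLambda n) (hDelta n) (nu_fin n).
rewrite invfM -[leLHS]mulrA [leRHS]mulrC.
rewrite ler_wpM2l ?invr_ge0 ?(ltW (sigma_pos n))//.
have s0 : 0 < Num.sqrt (fine (nu (Delta n))) by rewrite sqrtr_gt0.
rewrite -[X in X^-1]sqr_sqrtr ?(ltW (nu_pos n))//.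
rewrite ler_pdivrMl ?exprn_gt0//; apply: le_trans gC _.
rewrite mulrCA ler_wpM2l// expr2 -mulrA ler_peMr ?(ltW s0)//.
by rewrite ler_pdivlMr ?sqrtr_gt0// mul1r ler_wsqrtr.
Qed.

(** By [levy_letter_bound] the product of the two integrals is at most a multiple
    of [nu (Delta n)], whereas [V n = sigma (Lambda n) * nu (Delta n)]: the quotient
    vanishes because [sigma] is infinite.  The single factors [V n * mean n u] need
    not even be bounded. *)
Lemma cvg_V_mean_mean u g : letter u -> letter g ->
  V n * (mean n u * mean n g) @[n --> \oo] --> (0 : R).
Proof.
move=> lu lg.
have [C C0 bC] := levy_letter_bound sigma_radon nu_bounded nu_sqr lu.
have [D D0 bD] := levy_letter_bound sigma_radon nu_bounded nu_sqr lg.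
apply: (@cvg_bounded_by _ _ (C * D) _ cvg_inv_sigma) => n.
have [_ uC] := bC _ _ (hLambda n) (hDelta n) (nu_fin n).
have [_ gD] := bD _ _ (hLambda n) (hDelta n) (nu_fin n).
have V0 : 0 < V n by rewrite VE mulr_gt0.
rewrite !mean_normalized// [(V n)^-1 * _ * _]mulrACA !mulrA.
rewrite mulfV ?gt_eqF// mul1r.
rewrite -mulrA normrM ger0_norm ?invr_ge0 ?(ltW V0)// ler_pdivrMl// normrM.
apply: le_trans (ler_pM _ _ uC gD) _ => //.
rewrite mulrACA -expr2 sqr_sqrtr ?(ltW (nu_pos n))//.
by rewrite VE mulrCA ler_wpM2l ?mulr_ge0// mulrAC mulfV ?gt_eqF// mul1r.
Qed.

Let N_over_V n (x : R) : (N n)%:R * x = (N n)%:R / V n * (V n * x).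
Proof. by rewrite -mulrA mulKf// gt_eqF// VE mulr_gt0. Qed.

Lemma cvg_N_mean_mean u g : letter u -> letter g ->
  (N n)%:R * (mean n u * mean n g) @[n --> \oo] --> (0 : R).
Proof.
move=> lu lg; under eq_fun do rewrite N_over_V.
by rewrite -(mulr0 1); apply: cvgM => //; exact: cvg_V_mean_mean.
Qed.

Lemma cvg_N_mean g : letter g -> mu.-integrable setT (EFin \o g) ->
  (N n)%:R * mean n g @[n --> \oo] --> \int[mu]_z g z.
Proof.
move=> lg gi; under eq_fun => n.
  have V0 : V n != 0 by rewrite gt_eqF// VE mulr_gt0.
  rewrite N_over_V mean_normalized// mulVKf//.
  over.
rewrite -[\int[mu]_z g z]mul1r; apply: cvgM => //.
apply: cvg_Rintegral_exhaustion => //.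
- by move=> n; exact: borel_relcompact_setX.
- move=> n z [Lz Dz].
  by split; [exact: Lambda_nondecreasing|exact: Delta_nondecreasing].
- apply/seteqP; split=> // -[x s] _.
  have [i _ xi] : (\bigcup_n Lambda n) x by rewrite Lambda_cover.
  have [j _ sj] : (\bigcup_n Delta n) s by rewrite Delta_cover.
  exists (maxn i j) => //; split=> /=.
    exact: (nondecreasing_subset Lambda_nondecreasing (leq_maxl i j)).
  exact: (nondecreasing_subset Delta_nondecreasing (leq_maxr i j)).
Qed.

Lemma cvg_N1_mul (a : nat -> R) (l : R) : a @ \oo --> (0 : R) ->
  (N n)%:R * a n @[n --> \oo] --> l -> (N n).-1%:R * a n @[n --> \oo] --> l.
Proof.
move=> a0 Na; rewrite -[l]subr0.
under eq_fun do rewrite -subn1 natrB// mulrBl mul1r.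
exact: cvgB.
Qed.

Lemma cvg_contract (b : bool) u g : letter u -> letter g ->
  (if b then N n else (N n).-1)%:R * (mean n (u \* g) - mean n g * mean n u)
    @[n --> \oo] --> L2dot mu u g.
Proof.
move=> lu lg; have lug := levy_letterM lu lg.
have main : (N n)%:R * (mean n (u \* g) - mean n g * mean n u)
    @[n --> \oo] --> L2dot mu u g.
  under eq_fun do rewrite mulrBr.
  rewrite -[L2dot _ _ _]subr0; apply: cvgB; last exact: cvg_N_mean_mean.
  apply: cvg_N_mean => //.
  exact: levy_letterM_integrable.
case: b => //; apply: cvg_N1_mul => //.
rewrite -(subr0 0) -[X in _ - X](mulr0 0).
by apply: cvgB; [exact: cvg_mean|apply: cvgM; exact: cvg_mean].
Qed.

(** * Convergence of the moments *)

Context (K : forall n, free_product_space (P n) (N n)).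
Context (M : forall n, (X -> R) -> 'I_(N n) -> K n -> K n).
Hypothesis hM : forall n (f : X -> R) (i : 'I_(N n)),
  bounded_compact_support f -> free_multiplication (otimes_id f) i (M f i).
Context (F : full_fock_space mu).
Context (ap a0 am : (borel X * borel (Rstar R) -> R) -> F -> F).
Hypothesis hap : forall h, h \in Lfun mu 2%:E -> creation_operator h (ap h).
Hypothesis ham : forall h, h \in Lfun mu 2%:E -> adjoint_of (ap h) (am h).
Hypothesis ha0 : forall f : X -> R, bounded_compact_support f ->
  neutral_operator (multiplication (otimes_id f)) (a0 (otimes_id f)).

Local Notation fw n := (free_weights (P n) (N n)).

Lemma free_acts n f : bounded_compact_support f ->
  acts_on_words (free_word (K n)) (fw n) letter (otimes_id f)
    (free_sum (M (n := n) f)).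
Proof.
move=> bf; apply: free_sum_acts_on_words.
- exact: probability_normalized.
- exact: levy_letter_Lfun2_normalized.
- exact: levy_letterM.
- exact: levy_letter_otimes_id.
- by move=> i; exact: hM.
Qed.

Lemma vector_state_free_sum n f : bounded_compact_support f ->
  vector_state (free_vacuum (K n)) (free_sum (M (n := n) f)) =
  (N n)%:R * mean n (otimes_id f).
Proof.
move=> bf; have [B0 _] := free_acts n bf.
have dotW := @dot_free_word_vacuum _ _ _ _ _ (K n) (probability_normalized n)
  letter (fun g lg => levy_letter_Lfun2_normalized n lg).
rewrite /vector_state [free_sum _ _]B0 hdotDl hdotZl.
rewrite -[free_vacuum _]/(free_word (K n) [::]) !dotW//=.
  by rewrite mulr1 addr0.
by apply/good_word_cons; split => //; exact: levy_letter_otimes_id.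
Qed.

(** The shift by [e_ n u] covers the two cases at once: it is 0 for the operators
    themselves and [- (N n)%:R * mean n u] for the centered ones.  The loop weights
    at the empty word and elsewhere have the same limit since they differ by
    [mean n u], which tends to 0. *)
Lemma cvg_vector_state (e_ : nat -> (borel X * borel (Rstar R) -> R) -> R)
    (e : (borel X * borel (Rstar R) -> R) -> R) k (f : 'I_k -> X -> R) :
  (forall u, letter u -> (N n)%:R * mean n u + e_ n u @[n --> \oo] --> e u) ->
  (forall j, bounded_compact_support (f j)) ->
  vector_state (free_vacuum (K n)) (op_prod (fun j v =>
    free_sum (M (n := n) (f j)) v + e_ n (otimes_id (f j)) *: v))
    @[n --> \oo] -->
  vector_state (vacuum F) (op_prod (fun j v =>
    centered_free_levy_noise ap a0 am (f j) v + e (otimes_id (f j)) *: v)).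
Proof.
move=> cvge bf; pose u j := otimes_id (f j).
have lu j : letter (u j) by exact: levy_letter_otimes_id.
have lu2 g : letter g -> g \in Lfun mu 2%:E by exact: levy_letter_Lfun2.
have hapu j := hap (lu2 _ (lu j)).
have hamu j := ham (lu2 _ (lu j)).
have -> : vector_state (vacuum F) (op_prod (fun j v =>
    centered_free_levy_noise ap a0 am (f j) v + e (u j) *: v)) =
  moment (shift_weights e (fock_weights mu))
    (rev [seq u j | j <- index_enum 'I_k]) [::].
  apply: (@vector_state_op_prod _ _ _ (fock_tensor F) _ letter) => //.
  - exact: levy_letterM.
  - by move=> w lw; apply: dot_fock_tensor_vacuum lw.
  - move=> j; apply: linear_shift.
    exact: (linear_fock (hapu j) (hamu j) (ha0 (bf j))).
  - move=> j; apply: acts_on_words_shift.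
    exact: (fock_acts_on_words lu2 (lu j) (hapu j) (hamu j) (ha0 (bf j))).
under eq_fun => n.
  rewrite (@vector_state_op_prod _ _ _ (free_word (K n))
    (shift_weights (e_ n) (fw n)) letter _ u).
  - over.
  - exact: levy_letterM.
  - move=> w lw; apply: dot_free_word_vacuum lw.
      exact: probability_normalized.
    exact: levy_letter_Lfun2_normalized.
  - by [].
  - by move=> j; apply: linear_shift; apply: linear_free_sum => i; exact: hM.
  - by move=> j; apply: acts_on_words_shift; exact: free_acts.
apply: (@cvg_moment _ _ letter) => //=.
- exact: levy_letterM.
- by move=> v lv; rewrite add0r; exact: cvge.
- move=> v lv; rewrite add0r -[e v]subr0.
  under eq_fun do rewrite -subn1 natrB// mulrBl mul1r addrAC.
  by apply: cvgB; [exact: cvge|exact: cvg_mean].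
- by move=> v lv; exact: cvg_mean.
- by move=> b v g lv lg; exact: cvg_contract.
- by move=> g; rewrite mem_rev => /mapP[j _ ->].
Qed.

End exhaustion.

Theorem corollary15
  (R : realType) (X : ptopologicalType)
  (X_polish : polish R X) (X_loc_compact : locally_compact [set: X])
  (sigma : {measure set (borel X) -> \bar R})
  (sigma_radon : radon sigma) (sigma_non_atomic : non_atomic sigma)
  (sigma_infinite : sigma setT = +oo%E)
  (nu : {sigma_finite_measure set (borel (Rstar R)) -> \bar R})
  (nu_bounded : exists2 r : R, 0 < r & nu [set s | r < `|rval s|] = 0%E)
  (Lambda : nat -> set X) (Delta : nat -> set (Rstar R))
  (hLambda : forall n, borel_relcompact (Lambda n))
  (hDelta : forall n, borel_relcompact (Delta n))
  (Lambda_nondecreasing : forall n, Lambda n `<=` Lambda n.+1)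
  (Delta_nondecreasing : forall n, Delta n `<=` Delta n.+1)
  (Lambda_cover : \bigcup_n Lambda n = setT)
  (Delta_cover : \bigcup_n Delta n = setT)
  (V_gt0 : forall n, (0 < sigma (Lambda n) * nu (Delta n) < +oo)%E)
  (N : nat -> nat) (N_gt0 : forall n, (0 < N n)%N)
  (N_lim : (N n)%:R / fine (sigma (Lambda n) * nu (Delta n))%E
             @[n --> \oo] --> (1 : R))
  (K : forall n, free_product_space
         (normalized_restriction (sigma \x nu)%E
            (borel_relcompact_setX (hLambda n) (hDelta n))) (N n))
  (M : forall n, (X -> R) -> 'I_(N n) -> K n -> K n)
  (hM : forall n (f : X -> R) (i : 'I_(N n)), bounded_compact_support f ->
          free_multiplication (otimes_id f) i (M n f i))
  (F : full_fock_space (sigma \x nu)%E)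
  (ap a0 am : (borel X * borel (Rstar R) -> R) -> F -> F)
  (hap : forall h, h \in Lfun (sigma \x nu)%E 2%:E -> creation_operator h (ap h))
  (ham : forall h, h \in Lfun (sigma \x nu)%E 2%:E -> adjoint_of (ap h) (am h))
  (ha0 : forall f : X -> R, bounded_compact_support f ->
           neutral_operator (multiplication (otimes_id f)) (a0 (otimes_id f))) :
  ((\int[nu]_s (`|rval s|)%:E < +oo)%E ->
   forall (k : nat) (f : 'I_k -> X -> R), (0 < k)%N ->
   (forall j, bounded_compact_support (f j)) ->
   vector_state (free_vacuum (K n))
     (op_prod (fun j => free_sum (M n (f j)))) @[n --> \oo] -->
   vector_state (vacuum F)
     (op_prod (fun j => free_levy_noise sigma nu ap a0 am (f j))))
  /\
  ((\int[nu]_s (rval s ^+ 2)%:E < +oo)%E ->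
   forall (k : nat) (f : 'I_k -> X -> R), (0 < k)%N ->
   (forall j, bounded_compact_support (f j)) ->
   vector_state (free_vacuum (K n))
     (op_prod (fun j =>
        center_op (free_vacuum (K n)) (free_sum (M n (f j))))) @[n --> \oo] -->
   vector_state (vacuum F)
     (op_prod (fun j => centered_free_levy_noise ap a0 am (f j)))).
Proof.
have sigma_sf : sigma_finite setT sigma.
  exists Lambda; first by rewrite Lambda_cover.
  by move=> n; split; [case: (hLambda n)|exact: sigma_radon].
have [sg sgE] := sigma_finite_measure_of sigma_sf; subst sigma.
have cvg_state (nu_sqr : (\int[nu]_s (rval s ^+ 2)%:E < +oo)%E) e_ e k f :=
  @cvg_vector_state R X sg nu Lambda Delta N sigma_radon nu_bounded nu_sqr
    sigma_infinite hLambda hDelta Lambda_nondecreasing Delta_nondecreasing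
    Lambda_cover Delta_cover V_gt0 N_gt0 N_lim K M hM F ap a0 am hap ham ha0
    e_ e k f.
split=> [nu_abs|nu_sqr] k f _ bf.
  have s1 : (\int[nu]_s (`|rval s| ^+ 1)%:E < +oo)%E by [].
  have nu_sqr : (\int[nu]_s (rval s ^+ 2)%:E < +oo)%E.
    exact: (integrable_lty measurableT (integrable_rval_exprD nu_bounded 1 s1)).
  have letter_integrable u : levy_letter u ->
      (sg \x nu)%E.-integrable setT (EFin \o u).
    move=> [h [m [bh ->]]].
    have hi := integrable_bounded_compact_support sigma_radon bh.
    exact: (integrable_tensor_fun hi (integrable_rval_exprD nu_bounded m s1)).
  have := cvg_state nu_sqr (fun _ _ => 0) (Rintegral (sg \x nu)%E setT) k f _ bf.
  have -> : (fun j v => centered_free_levy_noise ap a0 am (f j) v +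
      Rintegral (sg \x nu)%E setT (otimes_id (f j)) *: v) =
      (fun j => free_levy_noise sg nu ap a0 am (f j)).
    apply/funext => j; apply/funext => v; congr (_ + _ *: _).
    apply: Rintegral_tensor_fun.
      exact: integrable_bounded_compact_support sigma_radon (bf j).
    have := integrable_rval_exprD nu_bounded 0 s1.
    by under eq_fun do rewrite expr1.
  under [X in X @ _ --> _]eq_fun => n.
    rewrite (_ : (fun j v => _) = (fun j => free_sum (M n (f j)))); last first.
      by apply/funext => j; apply/funext => v; rewrite scale0r addr0.
    over.
  apply=> u lu; under eq_fun do rewrite addr0.
  by apply: cvg_N_mean => //; exact: letter_integrable.
have := cvg_state nu_sqr (fun n u => - ((N n)%:R *
  Rintegral (normalized_restriction (sg \x nu)%E
    (borel_relcompact_setX (hLambda n) (hDelta n))) setT u)) (fun=> 0) k f _ bf.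
have -> : (fun j v => centered_free_levy_noise ap a0 am (f j) v + 0 *: v) =
    (fun j => centered_free_levy_noise ap a0 am (f j)).
  by apply/funext => j; apply/funext => v; rewrite scale0r addr0.
under [X in X @ _ --> _]eq_fun => n.
  rewrite (_ : (fun j v => _) = (fun j =>
      center_op (free_vacuum (K n)) (free_sum (M n (f j))))); last first.
    apply/funext => j; apply/funext => v; rewrite /center_op scaleNr.
    congr (_ - _ *: _).
    by rewrite (vector_state_free_sum sigma_radon nu_bounded nu_sqr V_gt0 hM).
  over.
by apply=> u lu; under eq_fun do rewrite subrr; exact: cvg_cst.
Qed.
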